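(* Let $(\widetilde{M},\widetilde{g},F)$ be an almost product-like Riemannian manifold and let $(M,g)$ be a tangential hypersurface of $\widetilde{M}$ with unit normal vector field $N$, and let $\varphi,\varphi^{\ast},\xi,\xi^{\ast},\eta,\eta^{\ast}$ be the induced objects on $M$. Then for every $X\in\Gamma(TM)$: $$\varphi^{2}X=X-\eta^{\ast}(X)\xi,\qquad \eta^{\ast}(\varphi X)=0,$$ $$(\varphi^{\ast})^{2}X=X-\eta(X)\xi^{\ast},\qquad \eta(\varphi^{\ast}X)=0,$$ $$\varphi\xi=0\quad\text{and}\quad \varphi^{\ast}\xi^{\ast}=0.$$
   Context: An almost product-like Riemannian manifold $(\widetilde{M},\widetilde{g},F)$ is a Riemannian manifold $(\widetilde{M},\widetilde{g})$ with a $(1,1)$-tensor field $F$ satisfying $F^{2}=I$, together with another $(1,1)$-tensor field $F^{\ast}$ satisfying $\widetilde{g}(FX,Y)=\widetilde{g}(X,F^{\ast}Y)$ for all vector fields $X,Y$ on $\widetilde{M}$. Let $(M,g)$ be a hypersurface of $\widetilde{M}$ with induced metric $g$ and unit normal vector field $N$. It is called a tangential hypersurface if $FN$ and $F^{\ast}N$ are tangent to $M$. In that case put $\xi=FN$ and $\xi^{\ast}=F^{\ast}N$, and for $X\in\Gamma(TM)$ decompose $$FX=\varphi X+\eta^{\ast}(X)N,\qquad F^{\ast}X=\varphi^{\ast}X+\eta(X)N,$$ where $\varphi X,\varphi^{\ast}X$ are tangent to $M$ and $\eta,\eta^{\ast}$ are $1$-forms on $M$. *)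

(* Defs.v *)
From HB Require Import structures.
From mathcomp Require Import all_boot all_order all_algebra.
From mathcomp Require Import all_classical all_reals all_analysis.
From mathcomp Require Import ring.

Set Implicit Arguments.
Unset Strict Implicit.
Unset Printing Implicit Defensive.

Import Order.TTheory GRing.Theory Num.Theory.
Import numFieldNormedType.Exports.

Local Open Scope classical_set_scope.
Local Open Scope ring_scope.

Section Ck.
Context {R : realType}.
Implicit Types V W : normedModType R.

(* In finite dimension, where it is used, [f] is C^(k+1) on the open set [U]
   iff it is differentiable on [U] and all its directional derivatives are
   C^k on [U]. *)
Fixpoint Ck V W (k : nat) (U : set V) (f : V -> W) : Prop :=
  match k with
  | 0 => forall x, U x -> {for x, continuous f}
  | k'.+1 => (forall x, U x -> differentiable f x) /\
             (forall v, Ck k' U ('D_v f))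
  end.

Definition smooth_on V W (U : set V) (f : V -> W) := forall k, Ck k U f.

Lemma differentiable_near0 V W (e : V -> W) (x : V) :
  (\forall y \near x, e y = 0) -> differentiable e x.
Proof.
move=> e0.
have ex : e x = 0 by exact: (nbhs_singleton e0).
have h : e \o shift x = cst (e x) + (\0 : {linear V -> W}) +o_ 0 id.
  apply/eqaddoP => _/posnumP[eps].
  have : \forall y \near 0, e (y + x) = 0.
    move: e0; rewrite (near_shift 0 x) /= subr0 => H.
    by near=> y; have : (e \o shift x) y = 0 by near: y.
  apply: filterS => y /= ey; rewrite !fctE /= ey ex addr0 subr0 normr0.
  by rewrite mulr_ge0.
have c0 : continuous (\0 : {linear V -> W}) by exact: cst_continuous.
by apply/diff_locallyP; rewrite (diff_unique c0 h).
Unshelve. all: by end_near. Qed.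

Lemma near_eq_differentiable V W (f g : V -> W) (x : V) :
  (\forall y \near x, f y = g y) -> differentiable f x -> differentiable g x.
Proof.
move=> fg df; rewrite (_ : g = f + (g - f)); last by rewrite addrC subrK.
apply: differentiableD => //; apply: differentiable_near0.
by apply: filterS fg => y; rewrite !fctE => ->; rewrite subrr.
Qed.

Lemma near_eq_derive V W (f g : V -> W) (x v : V) :
  (\forall y \near x, f y = g y) -> differentiable f x -> 'D_v f x = 'D_v g x.
Proof.
move=> fg df; rewrite [in RHS](_ : g = f + (g - f)); last first.
  by rewrite addrC subrK.
have gf0 : \forall y \near x, (g - f) y = 0.
  by apply: filterS fg => y; rewrite !fctE => ->; rewrite subrr.
have dgf := differentiable_near0 gf0.
rewrite deriveD; [|exact: diff_derivable..].
suff -> : 'D_v (g - f) x = 0 by rewrite addr0.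
apply/cvg_lim => //; apply: cvg_near_cst.
suff : \forall h \near 0^', (g - f) (h *: v + x) = 0.
  by apply: filterS => h /= ->; rewrite (nbhs_singleton gf0) subrr scaler0.
apply: nbhs_dnbhs.
have : (fun h : R => h *: v + x) @ 0 --> x.
  rewrite -[X in _ --> X]add0r -[X in X + _](scale0r v).
  by apply: cvgD; [exact: scalel_continuous|exact: cvg_cst].
by move=> /(_ _ gf0).
Qed.

Lemma Ck_sub V W k (U U' : set V) (f : V -> W) :
  U' `<=` U -> Ck k U f -> Ck k U' f.
Proof.
move=> U'U; elim: k f => [|k IH] f /=; first by move=> + x /U'U; apply.
move=> [df Df]; split=> [x /U'U/df//|v]; exact: IH (Df v).
Qed.

Lemma CkW V W k (U : set V) (f : V -> W) : Ck k.+1 U f -> Ck k U f.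
Proof.
elim: k f => [|k IH] f [df Df]; first by move=> x /df/differentiable_continuous.
by split=> // v; exact: IH.
Qed.

Lemma Ck_loc V W k (U : set V) (f : V -> W) :
  (forall x, U x -> exists2 B : set V, B x & Ck k B f) -> Ck k U f.
Proof.
elim: k f => [|k IH] f fU /=.
  by move=> x /fU[B Bx] /(_ x Bx).
split=> [x Ux|v].
  by have [B Bx [df _]] := fU _ Ux; exact: df.
by apply: IH => x /fU[B Bx [_ Df]]; exists B => //; exact: Df.
Qed.

Lemma eq_Ck V W k (U : set V) (f g : V -> W) : open U ->
  (forall x, U x -> f x = g x) -> Ck k U f -> Ck k U g.
Proof.
move=> oU; elim: k f g => [|k IH] f g fg /=.
  move=> cf x Ux; have fgx : \forall y \near x, f y = g y.
    by apply: filterS (open_nbhs_nbhs (conj oU Ux)) => y /fg.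
  rewrite /prop_for/continuous_at -(fg _ Ux).
  exact: (cvg_trans (near_eq_cvg fgx) (cf _ Ux)).
move=> [df Df].
have fgx x : U x -> \forall y \near x, f y = g y.
  by move=> Ux; apply: filterS (open_nbhs_nbhs (conj oU Ux)) => y /fg.
split=> [x Ux|v]; first exact: near_eq_differentiable (fgx _ Ux) (df _ Ux).
by apply: IH (Df v) => x Ux; apply: near_eq_derive; [exact: fgx|exact: df].
Qed.

Lemma Ck_cst V W k (U : set V) (c : W) : Ck k U (cst c).
Proof.
elim: k c => [|k IH] c /=; first by move=> x _; exact: cst_continuous.
split=> // v; rewrite (_ : 'D_v _ = cst 0); first exact: IH.
by apply/funext => x; exact: derive_cst.
Qed.

Lemma CkD V W k (U : set V) (f g : V -> W) : open U ->
  Ck k U f -> Ck k U g -> Ck k U (f + g).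
Proof.
move=> oU; elim: k f g => [|k IH] f g.
  by move=> cf cg x Ux; apply: continuousD; [exact: cf|exact: cg].
move=> [df Df] [dg Dg]; split=> [x Ux|v].
  by apply: differentiableD; [exact: df|exact: dg].
apply: (eq_Ck oU _ (IH _ _ (Df v) (Dg v))) => x Ux.
by rewrite deriveD//; apply: diff_derivable; [exact: df|exact: dg].
Qed.

Lemma Ck_sum V W k (U : set V) m (f : 'I_m -> V -> W) : open U ->
  (forall i, Ck k U (f i)) -> Ck k U (\sum_i f i).
Proof.
move=> oU Cf; elim/big_ind: _ => [|? ? ? ?|//]; first exact: (@Ck_cst V W k U 0).
exact: CkD.
Qed.

Lemma CkM V k (U : set V) (f g : V -> R) : open U ->
  Ck k U f -> Ck k U g -> Ck k U (f * g).
Proof.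
move=> oU; elim: k f g => [|k IH] f g.
  by move=> cf cg x Ux; apply: continuousM; [exact: cf|exact: cg].
move=> Cf Cg; have [Cf' Cg'] := (CkW Cf, CkW Cg).
case: Cf Cg => [df Df] [dg Dg]; split=> [x Ux|v].
  by apply: differentiableM; [exact: df|exact: dg].
apply: (eq_Ck oU _ (CkD oU (IH _ _ Cf' (Dg v)) (IH _ _ Cg' (Df v)))) => x Ux.
by rewrite deriveM//; apply: diff_derivable; [exact: df|exact: dg].
Qed.

Lemma Ck_coord V k (U : set V) m (g : V -> 'rV[R]_m) i : open U ->
  Ck k U g -> Ck k U (fun x => g x 0 i).
Proof.
move=> oU; elim: k g => [|k IH] g.
  move=> cg x Ux.
  exact: (@continuous_comp _ _ _ g (fun M : 'rV_m => M 0 i) _ (cg _ Ux)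
            (@coord_continuous _ _ _ 0 i (g x))).
move=> [dg Dg]; split=> [x Ux|v].
  exact: differentiable_comp (dg _ Ux) (differentiable_coord _ _ _).
apply: (eq_Ck oU _ (IH _ (Dg v))) => x Ux.
by rewrite derive_mx ?mxE//; exact/diff_derivable/dg.
Qed.

Lemma Ck_comp V k m (U : set V) (O : set 'rV[R]_m)
    (g : V -> 'rV[R]_m) (f : 'rV[R]_m -> R) :
  open U -> (forall x, U x -> O (g x)) -> Ck k U g -> Ck k O f ->
  Ck k U (f \o g).
Proof.
move=> oU gUO; elim: k f => [|k IH] f Cg.
  by move=> cf x Ux; apply: continuous_comp; [exact: Cg|exact/cf/gUO].
have Cg' := CkW Cg.
case: Cg => [dg Dg] [df Df]; split=> [x Ux|v].
  by apply: differentiable_comp; [exact: dg|exact/df/gUO].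
pose s := \sum_(i < m) ((fun x => 'D_v g x 0 i) *
                        ('D_(delta_mx 0 i) f \o g) : V -> R).
apply: (eq_Ck (f := s) oU) => [x Ux|]; last first.
  apply: Ck_sum => // i; apply: CkM => //; first exact: Ck_coord (Dg v).
  exact: IH (Cg') (Df _).
have [dgx dfx] := (dg _ Ux, df _ (gUO _ Ux)).
rewrite /s fct_sumE deriveE; last exact: differentiable_comp.
rewrite diff_comp//= -(deriveE _ dgx) [in RHS](row_sum_delta ('D_v g x)).
rewrite linear_sum; apply: eq_bigr => i _.
by rewrite linearZ /= -(deriveE _ dfx).
Qed.

End Ck.

Section Manifold.
Context {R : realType}.

Record chart (T : topologicalType) (n : nat) := Chart {
  chart_source : set T ;
  chart_target : set 'rV[R]_n ;
  chart_map :> T -> 'rV[R]_n ;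
  chart_inv : 'rV[R]_n -> T ;
  chart_source_open : open chart_source ;
  chart_target_open : open chart_target ;
  chart_mapP : forall x, chart_source x -> chart_target (chart_map x) ;
  chart_invP : forall y, chart_target y -> chart_source (chart_inv y) ;
  chart_mapK : forall x, chart_source x -> chart_inv (chart_map x) = x ;
  chart_invK : forall y, chart_target y -> chart_map (chart_inv y) = y ;
  chart_map_cont : forall x, chart_source x -> {for x, continuous chart_map} ;
  chart_inv_cont : forall y, chart_target y -> {for y, continuous chart_inv}
}.

(* The atlas need not be maximal: smoothness does not depend on which atlas
   of the given smooth structure is used. *)
Record manifold (n : nat) := Manifold {
  manifold_space :> topologicalType ;
  manifold_hausdorff : hausdorff_space manifold_space ;
  manifold_countable : @second_countable manifold_space ;
  atlas : set (chart manifold_space n) ;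
  atlas_cover : forall x, exists2 c, atlas c & chart_source c x ;
  atlas_compatible : forall c d, atlas c -> atlas d ->
    smooth_on [set y | chart_target c y /\ chart_source d (chart_inv c y)]
              (d \o chart_inv c)
}.

Definition smooth_function n (M : manifold n) (f : M -> R) : Prop :=
  forall c, @atlas n M c -> smooth_on (chart_target c) (f \o chart_inv c).

Record smooth_fun n (M : manifold n) := SmoothFun {
  smooth_fun_val :> M -> R ;
  smooth_funP : smooth_function smooth_fun_val
}.

Record smooth_map m n (M : manifold m) (N : manifold n) := SmoothMap {
  smooth_map_val :> M -> N ;
  smooth_map_cont : continuous smooth_map_val ;
  smooth_mapP : forall c d, @atlas m M c -> @atlas n N d ->
    smooth_on [set y | chart_target c y /\
                       chart_source d (smooth_map_val (chart_inv c y))]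
              (d \o smooth_map_val \o chart_inv c)
}.

Lemma smooth_function_comp m n (M : manifold m) (N : manifold n)
    (i : smooth_map M N) (f : smooth_fun N) : smooth_function (f \o i).
Proof.
move=> c Mc k; apply: Ck_loc => y cy.
have [d Nd di] := atlas_cover (i (chart_inv c y)).
pose B := [set y | chart_target c y /\ chart_source d (i (chart_inv c y))].
exists B => //; have oB : open B.
  rewrite openE => z [cz dz]; rewrite /interior.
  have cz' : nbhs z (chart_target c).
    by apply: open_nbhs_nbhs; split=> //; exact: chart_target_open.
  have dz' : nbhs (i (chart_inv c z)) (chart_source d).
    by apply: open_nbhs_nbhs; split=> //; exact: chart_source_open.
  have ic : {for z, continuous (i \o chart_inv c)}.
    apply: continuous_comp; first exact: chart_inv_cont.
    exact: smooth_map_cont.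
  exact: filterI cz' (ic _ dz').
apply: (eq_Ck oB (f := (f \o chart_inv d) \o (d \o i \o chart_inv c))).
  by move=> z [cz dz]; rewrite /= chart_mapK.
apply: (Ck_comp (O := chart_target d)) => //.
- by move=> z [cz dz]; exact: chart_mapP.
- exact: smooth_mapP.
- exact: smooth_funP.
Qed.

Definition smooth_pullback m n (M : manifold m) (N : manifold n)
    (i : smooth_map M N) (f : smooth_fun N) : smooth_fun M :=
  SmoothFun (smooth_function_comp i f).

End Manifold.

Section Tangent.
Context {R : realType}.

(* Tangent vectors at [p] are the derivations at [p] of the algebra of
   smooth functions. *)
Definition derivation_at n (M : manifold (R := R) n) (p : M) :
    {pred smooth_fun M -> R} := fun D => `[<
  (forall (a : R) (f g h : smooth_fun M),
     (forall x, h x = a * f x + g x) -> D h = a * D f + D g) /\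
  (forall f g h : smooth_fun M,
     (forall x, h x = f x * g x) -> D h = D f * g p + f p * D g) >].

Lemma derivation_at_submod n (M : manifold n) (p : M) :
  submod_closed (derivation_at p).
Proof.
split=> [|a D E]; rewrite /derivation_at !unfold_in.
  apply/asboolP; split=> [a f g h _|f g h _] /=; first by rewrite mulr0 addr0.
  by rewrite mul0r mulr0 addr0.
move=> /asboolP[Dl DL] /asboolP[El EL]; apply/asboolP.
split=> [b f g h hE|f g h hE]; rewrite !fctE.
  by rewrite (Dl _ _ _ _ hE) (El _ _ _ _ hE) /= /GRing.scale /=; ring.
by rewrite (DL _ _ _ hE) (EL _ _ _ hE) /= /GRing.scale /=; ring.
Qed.

HB.instance Definition _ n (M : manifold n) (p : M) :=
  GRing.isSubmodClosed.Build R _ (derivation_at p) (derivation_at_submod p).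

Record tangent n (M : manifold n) (p : M) := Tangent {
  tangent_val :> smooth_fun M -> R ;
  tangentP : tangent_val \in derivation_at p
}.

HB.instance Definition _ n (M : manifold n) (p : M) :=
  [isSub for @tangent_val n M p].
HB.instance Definition _ n (M : manifold n) (p : M) :=
  [Choice of tangent p by <:].
HB.instance Definition _ n (M : manifold n) (p : M) :=
  [SubChoice_isSubLmodule of tangent p by <:].

Lemma differential_subproof m n (M : manifold m) (N : manifold n)
    (i : smooth_map M N) (p : M) (u : tangent p) :
  (fun f => u (smooth_pullback i f)) \in derivation_at (i p).
Proof.
have /asboolP[ul uL] := tangentP u.
apply/asboolP; split=> [a f g h hE|f g h hE]; first by apply: ul => x /=.
exact: (uL (smooth_pullback i f) (smooth_pullback i g)
          (smooth_pullback i h) (fun x => hE (i x))).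
Qed.

Definition differential m n (M : manifold m) (N : manifold n)
    (i : smooth_map M N) (p : M) (u : tangent p) : tangent (i p) :=
  Tangent (differential_subproof i u).

(* Smoothness of vector fields, forms and tensor fields is tested on globally
   defined functions and vector fields; by bump functions this is the same as
   smoothness of the components in charts. *)
Record vector_field n (M : manifold n) := VectorField {
  vector_field_val :> forall p : M, tangent p ;
  vector_fieldP : forall f : smooth_fun M,
    smooth_function (fun p => vector_field_val p f)
}.

Record vector_field_along m n (M : manifold m) (N : manifold n)
    (i : smooth_map M N) := VectorFieldAlong {
  vector_field_along_val :> forall p : M, tangent (i p) ;
  vector_field_alongP : forall f : smooth_fun N,
    smooth_function (fun p => vector_field_along_val p f)
}.

Record one_form n (M : manifold n) := OneForm {
  one_form_val :> forall p : M, tangent p -> R ;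
  one_form_linear : forall (p : M) (a : R) (u v : tangent p),
    one_form_val (a *: u + v) = a * one_form_val u + one_form_val v ;
  one_form_smooth : forall X : vector_field M,
    smooth_function (fun p => one_form_val (X p))
}.

Record tensor11 n (M : manifold n) := Tensor11 {
  tensor11_val :> forall p : M, tangent p -> tangent p ;
  tensor11_linear : forall (p : M) (a : R) (u v : tangent p),
    tensor11_val (a *: u + v) = a *: tensor11_val u + tensor11_val v ;
  tensor11_smooth : forall (X : vector_field M) (f : smooth_fun M),
    smooth_function (fun p => tensor11_val (X p) f)
}.

Record riemannian_metric n (M : manifold n) := RiemannianMetric {
  riemannian_val :> forall p : M, tangent p -> tangent p -> R ;
  riemannian_linear : forall (p : M) (a : R) (u v w : tangent p),
    riemannian_val (a *: u + v) w = a * riemannian_val u w + riemannian_val v w ;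
  riemannian_sym : forall (p : M) (u v : tangent p),
    riemannian_val u v = riemannian_val v u ;
  riemannian_posdef : forall (p : M) (u : tangent p),
    u != 0 -> 0 < riemannian_val u u ;
  riemannian_smooth : forall X Y : vector_field M,
    smooth_function (fun p => riemannian_val (X p) (Y p))
}.

(* An immersed submanifold is a manifold [M] with an immersion [i : M -> N];
   [i] need not be injective. *)
Definition immersion m n (M : manifold m) (N : manifold n)
    (i : smooth_map M N) : Prop :=
  forall p : M, injective (@differential m n M N i p).

Definition induced_metric m n (M : manifold m) (N : manifold n)
    (i : smooth_map M N) (gN : riemannian_metric N)
    (gM : riemannian_metric M) : Prop :=
  forall (p : M) (u v : tangent p),
    gM p u v = gN (i p) (differential i u) (differential i v).

Definition unit_normal m n (M : manifold m) (N : manifold n)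
    (i : smooth_map M N) (gN : riemannian_metric N)
    (nu : vector_field_along i) : Prop :=
  forall p : M, gN (i p) (nu p) (nu p) = 1 /\
    forall u : tangent p, gN (i p) (nu p) (differential i u) = 0.

End Tangent.

Section AlmostProductLike.
Context {R : realType}.

(* Identities between tensor fields are stated at each point, for all tangent
   vectors there. *)
Record almost_product_like n (M : manifold (R := R) n)
    (g : riemannian_metric M) := AlmostProductLike {
  apl_F : tensor11 M ;
  apl_Fstar : tensor11 M ;
  apl_F_involutive : forall (p : M) (u : tangent p),
    apl_F p (apl_F p u) = u ;
  apl_adjoint : forall (p : M) (u v : tangent p),
    g p (apl_F p u) v = g p u (apl_Fstar p v)
}.

(* Vectors of the hypersurface [i : M -> Mt] are compared with vectors of the
   ambient manifold through the differential of [i]. *)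
Definition tangential_hypersurface n (Mt : manifold n.+1)
    (gt : riemannian_metric Mt) (S : almost_product_like gt) (M : manifold n)
    (i : smooth_map M Mt) (N : vector_field_along i) : Prop :=
  forall p : M,
    (exists u : tangent p, apl_F S (i p) (N p) = differential i u) /\
    (exists u : tangent p, apl_Fstar S (i p) (N p) = differential i u).

Record induced_objects n (Mt : manifold n.+1) (gt : riemannian_metric Mt)
    (S : almost_product_like gt) (M : manifold n) (i : smooth_map M Mt)
    (N : vector_field_along i) := InducedObjects {
  ind_phi : tensor11 M ;
  ind_phistar : tensor11 M ;
  ind_xi : vector_field M ;
  ind_xistar : vector_field M ;
  ind_eta : one_form M ;
  ind_etastar : one_form M ;
  ind_xiE : forall p : M,
    differential i (ind_xi p) = apl_F S (i p) (N p) ;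
  ind_xistarE : forall p : M,
    differential i (ind_xistar p) = apl_Fstar S (i p) (N p) ;
  ind_F_decomp : forall (X : vector_field M) (p : M),
    apl_F S (i p) (differential i (X p)) =
    differential i (ind_phi p (X p)) + ind_etastar p (X p) *: N p ;
  ind_Fstar_decomp : forall (X : vector_field M) (p : M),
    apl_Fstar S (i p) (differential i (X p)) =
    differential i (ind_phistar p (X p)) + ind_eta p (X p) *: N p
}.

End AlmostProductLike.

(* Main.v *)
(* Apply F to F X = phi X + etas(X) N and compare tangential and normal parts,
   using F^2 = I and F N = xi; likewise N = F (F N) = F xi gives phi xi = 0.
   The starred identities are the same statement for F^*, whose square is the
   identity because it is the adjoint of F^2. *)
Require Import Defs.
From mathcomp Require Import all_boot all_order all_algebra.
From mathcomp Require Import all_classical all_reals all_analysis.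

Set Implicit Arguments.
Unset Strict Implicit.
Unset Printing Implicit Defensive.

Import Order.TTheory GRing.Theory Num.Theory.
Local Open Scope ring_scope.

(** Tangent vectors are added and scaled as functionals on smooth functions, and the differential
    only precomposes with the pullback, so both sides agree on each [f] by computation. *)
Lemma differential_linear (R : realType) (m n : nat) (M : @manifold R m)
    (N : @manifold R n) (i : smooth_map M N) (p : M) :
  linear (@differential R m n M N i p).
Proof. by move=> a u v; apply/val_inj/funext => f. Qed.

Lemma differentialD (R : realType) (m n : nat) (M : @manifold R m)
    (N : @manifold R n) (i : smooth_map M N) (p : M) (u v : tangent p) :
  differential i (u + v) = differential i u + differential i v.
Proof. by have := differential_linear i 1 u v; rewrite !scale1r. Qed.

Lemma differential0 (R : realType) (m n : nat) (M : @manifold R m)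
    (N : @manifold R n) (i : smooth_map M N) (p : M) :
  differential i (0 : tangent p) = 0.
Proof. by apply: (addrI (differential i 0)); rewrite -differentialD !addr0. Qed.

Lemma differentialZ (R : realType) (m n : nat) (M : @manifold R m)
    (N : @manifold R n) (i : smooth_map M N) (p : M) (a : R) (u : tangent p) :
  differential i (a *: u) = a *: differential i u.
Proof.
by have := differential_linear i a u 0; rewrite !addr0 differential0 addr0.
Qed.

Lemma riemannianDr (R : realType) (n : nat) (M : @manifold R n)
    (g : riemannian_metric M) (p : M) (w u v : tangent p) :
  g p w (u + v) = g p w u + g p w v.
Proof.
rewrite !(riemannian_sym g w) -[u in LHS]scale1r.
by rewrite riemannian_linear mul1r.
Qed.

Lemma riemannian0r (R : realType) (n : nat) (M : @manifold R n)
    (g : riemannian_metric M) (p : M) (w : tangent p) : g p w 0 = 0.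
Proof. by apply: (addrI (g p w 0)); rewrite -riemannianDr !addr0. Qed.

Lemma riemannianZr (R : realType) (n : nat) (M : @manifold R n)
    (g : riemannian_metric M) (p : M) (a : R) (w u : tangent p) :
  g p w (a *: u) = a * g p w u.
Proof.
rewrite riemannian_sym -[a *: u]addr0 riemannian_linear.
by rewrite !(riemannian_sym g _ w) riemannian0r addr0.
Qed.

(** If [u - v] were nonzero, the choice [w = u - v] would give it squared length 0, against positive
    definiteness. *)
Lemma riemannian_nondegenerate (R : realType) (n : nat) (M : @manifold R n)
    (g : riemannian_metric M) (p : M) (u v : tangent p) :
  (forall w : tangent p, g p w u = g p w v) -> u = v.
Proof.
move=> guv; apply/eqP; rewrite -subr_eq0; apply/negPn/negP => uv0.
have := riemannian_posdef g uv0.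
rewrite riemannianDr -scaleN1r riemannianZr guv mulN1r subrr.
by rewrite ltxx.
Qed.

Lemma apl_Fstar_involutive (R : realType) (n : nat) (M : @manifold R n)
    (g : riemannian_metric M) (S : almost_product_like g) (p : M)
    (u : tangent p) :
  apl_Fstar S p (apl_Fstar S p u) = u.
Proof.
apply: (@riemannian_nondegenerate _ _ _ g) => w.
by rewrite -!apl_adjoint apl_F_involutive.
Qed.

(** Pairing with the unit normal kills the tangential parts and leaves [a = b]; cancelling the
    normal terms then reduces [u = v] to injectivity of the differential. *)
Lemma tangent_normal_uniq (R : realType) (m n : nat) (M : @manifold R m)
    (Mt : @manifold R n) (gt : riemannian_metric Mt) (i : smooth_map M Mt)
    (i_immersion : immersion i) (N : vector_field_along i)
    (N_normal : unit_normal gt N) (p : M) (u v : tangent p) (a b : R) :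
  differential i u + a *: N p = differential i v + b *: N p ->
  u = v /\ a = b.
Proof.
move=> uv; have [NN Nt] := N_normal p.
have ab : a = b.
  have := congr1 (gt (i p) (N p)) uv.
  by rewrite !riemannianDr !riemannianZr !Nt NN !add0r !mulr1.
split=> //; apply: i_immersion.
by move: uv; rewrite ab => /addIr.
Qed.

(** The decomposition of F is given along vector fields only; bundling phi X as a field allows it to
    be applied a second time. *)
Definition tensor11_apply (R : realType) (n : nat) (M : @manifold R n)
    (T : tensor11 M) (X : vector_field M) : vector_field M :=
  VectorField (tensor11_smooth T X).

(** Only the involutivity of [F] and its splitting along the hypersurface enter, with no mention of
    an adjoint, so the same statement serves both F and F^*. *)
Lemma tangential_involution (R : realType) (m n : nat) (M : @manifold R m)
    (Mt : @manifold R n) (gt : riemannian_metric Mt) (i : smooth_map M Mt)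
    (i_immersion : immersion i) (N : vector_field_along i)
    (N_normal : unit_normal gt N) (F : tensor11 Mt) (phi : tensor11 M)
    (xi : vector_field M) (eta : one_form M) :
  (forall (q : Mt) (u : tangent q), F q (F q u) = u) ->
  (forall p : M, differential i (xi p) = F (i p) (N p)) ->
  (forall (X : vector_field M) (p : M), F (i p) (differential i (X p)) =
     differential i (phi p (X p)) + eta p (X p) *: N p) ->
  (forall (X : vector_field M) (p : M),
     phi p (phi p (X p)) = X p - eta p (X p) *: xi p /\
     eta p (phi p (X p)) = 0) /\
  (forall p : M, phi p (xi p) = 0).
Proof.
move=> FF xiE FE; split=> [X p|p].
  (* Both sides are F (F X): the left one expanded by two decompositions and F N = xi, the right one
     being X itself, whose normal coefficient is 0. *)
  have FX : differential i (phi p (phi p (X p)) + eta p (X p) *: xi p) +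
            eta p (phi p (X p)) *: N p = differential i (X p) + 0 *: N p.
    (* The normal term is moved to the front to match the shape [a *: u + v] of
       [tensor11_linear]. *)
    rewrite scale0r addr0 -[RHS]FF FE [in RHS]addrC.
    rewrite tensor11_linear (FE (tensor11_apply phi X)) /=.
    by rewrite differentialD differentialZ xiE [RHS]addrC addrAC.
  have [XE ->] := tangent_normal_uniq i_immersion N_normal FX.
  by split=> //; rewrite -[X in X - _]XE addrK.
(* F xi = F (F N) = N has tangential part 0 and normal coefficient 1. *)
have FX : differential i (phi p (xi p)) + eta p (xi p) *: N p =
          differential i 0 + 1 *: N p.
  by rewrite -FE xiE FF differential0 add0r scale1r.
by have [] := tangent_normal_uniq i_immersion N_normal FX.
Qed.

Theorem lemma4p3 (R : realType) (n : nat)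
  (Mt : @manifold R n.+1) (gt : riemannian_metric Mt)
  (P : almost_product_like gt)
  (M : @manifold R n) (g : riemannian_metric M)
  (i : smooth_map M Mt) (i_immersion : immersion i)
  (g_induced : induced_metric i gt g)
  (N : vector_field_along i) (N_normal : unit_normal gt N)
  (M_tangential : tangential_hypersurface P N)
  (ind : induced_objects P N) :
  let phi := ind_phi ind in let phis := ind_phistar ind in
  let xi := ind_xi ind in let xis := ind_xistar ind in
  let eta := ind_eta ind in let etas := ind_etastar ind in
  (forall (X : vector_field M) (p : M),
    [/\ phi p (phi p (X p)) = X p - etas p (X p) *: xi p,
        etas p (phi p (X p)) = 0,
        phis p (phis p (X p)) = X p - eta p (X p) *: xis p
      & eta p (phis p (X p)) = 0]) /\
  (forall p : M, phi p (xi p) = 0 /\ phis p (xis p) = 0).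
Proof.
move=> phi phis xi xis eta etas.
(* The stars cross over: the normal coefficient of F X is [etas], and that of F^* X is [eta]. *)
have [phi2 phi_xi] := tangential_involution i_immersion N_normal
  (@apl_F_involutive _ _ _ _ P) (ind_xiE ind) (ind_F_decomp ind).
have [phis2 phis_xis] := tangential_involution i_immersion N_normal
  (@apl_Fstar_involutive _ _ _ _ P) (ind_xistarE ind) (ind_Fstar_decomp ind).
split=> [X p|p]; last by split; [exact: phi_xi|exact: phis_xis].
have [? ?] := phi2 X p; have [? ?] := phis2 X p.
by split.
Qed.
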